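(* Let $K$ be an infinite field, let $m\in\mathbb{N}$ and $(n_1,\dots,n_m)\in\mathbb{N}^m$, and let $S=K[x_{ij} : 1\leq i\leq m,\ 1\leq j\leq n_i]$ with the $\mathbb{Z}^m$-grading given by $\deg(x_{ij})=e_i$. Let $I,J\subset S$ be Borel fixed ideals with the same multigraded Hilbert series, $\mathrm{HS}(I,y)=\mathrm{HS}(J,y)$. If $I$ is radical, then $I=J$.
   Context: Here $e_1,\dots,e_m$ is the standard basis of $\mathbb{Z}^m$. For a finitely generated $\mathbb{Z}^m$-graded $S$-module $M$, its multigraded Hilbert series is $\mathrm{HS}(M,y)=\sum_{a\in\mathbb{Z}^m}(\dim_K M_a)\,y^a$, where $y^a=y_1^{a_1}\cdots y_m^{a_m}$. The group $G=\mathrm{GL}_{n_1}(K)\times\cdots\times\mathrm{GL}_{n_m}(K)$ acts on $S$ by $\mathbb{Z}^m$-graded $K$-algebra automorphisms (the $i$-th factor acting linearly on the span of $x_{i1},\dots,x_{in_i}$). Let $B=B_{n_1}(K)\times\cdots\times B_{n_m}(K)\subset G$ be the Borel subgroup of upper triangular matrices with arbitrary non-zero diagonal entries; thus $g=(g_1,\dots,g_m)\in B$ acts by $x_{ij}\mapsto\sum_{k\leq j}(g_i)_{kj}x_{ik}$. An ideal $I\subset S$ is Borel fixed if $g(I)=I$ for every $g\in B$. (Borel fixed ideals are monomial ideals.) *)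

(* Defs.v *)
From mathcomp Require Import all_boot all_order all_algebra.
From mathcomp Require Import boolp classical_sets functions cardinality.
From mathcomp Require Import mpoly.

Set Implicit Arguments.
Unset Strict Implicit.
Unset Printing Implicit Defensive.

Import GRing.Theory.
Local Open Scope classical_set_scope.
Local Open Scope ring_scope.

(* The variables x_ij, i : 'I_m, j : 'I_(n i), are enumerated block by block by
   'I_(\sum_i n i): x_ij is the variable of index tagnat.Rank i j, and the
   variable of index v is x_ij for i = tagnat.sig1 v and j = tagnat.sig2 v. *)
Notation multi_mpoly K n := {mpoly K[\sum_i n i]}.

Definition xvar (K : fieldType) (m : nat) (n : 'I_m -> nat) (i : 'I_m)
  (j : 'I_(n i)) : multi_mpoly K n := 'X_(tagnat.Rank i j).

Definition is_ideal (R : comNzRingType) (I : set R) : Prop :=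
  [/\ I 0, forall f g, I f -> I g -> I (f + g) & forall h f, I f -> I (h * f)].

Definition radical (R : comNzRingType) (I : set R) : set R :=
  [set f | exists k : nat, I (f ^+ k)].

Section Dimension.
Variables (K : fieldType) (L : lmodType K).

Definition is_basis (V : set L) (d : nat) (b : 'I_d -> L) : Prop :=
  (forall i, V (b i)) /\
  forall v, V v -> exists! c : 'rV[K]_d, v = \sum_i c 0 i *: b i.

(* The dimension of a linear subspace V of L, provided that V has a finite
   basis; the value is the junk 0 otherwise. *)
Definition dimK (V : set L) : nat :=
  xget 0%N [set d | exists b : 'I_d -> L, is_basis V b].

Lemma is_basis_leq (V : set L) (d1 d2 : nat) (b1 : 'I_d1 -> L)
  (b2 : 'I_d2 -> L) : is_basis V b1 -> is_basis V b2 -> (d1 <= d2)%N.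
Proof.
move=> [Vb1 cb1] [Vb2 cb2].
have /choice[A hA] : forall i, exists c : 'rV[K]_d2, b1 i = \sum_j c 0 j *: b2 j.
  by move=> i; have [c [hc _]] := cb2 _ (Vb1 i); exists c.
have /choice[B hB] : forall j, exists c : 'rV[K]_d1, b2 j = \sum_i c 0 i *: b1 i.
  by move=> j; have [c [hc _]] := cb1 _ (Vb2 j); exists c.
pose MA := \matrix_(i < d1, j < d2) A i 0 j.
pose MB := \matrix_(j < d2, i < d1) B j 0 i.
suff MAB : MA *m MB = 1%:M.
  by rewrite -(mxrank1 K d1) -MAB (leq_trans (mxrankM_maxl _ _)) ?rank_leq_col.
apply/row_matrixP => i.
have [c [_ uc]] := cb1 _ (Vb1 i).
transitivity c; [apply/esym|]; apply: uc.
  transitivity (\sum_j A i 0 j *: \sum_k B j 0 k *: b1 k).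
    by rewrite {1}hA; apply: eq_bigr => j _; rewrite -hB.
  under eq_bigr do rewrite scaler_sumr.
  rewrite exchange_big /=; apply: eq_bigr => k _.
  rewrite !mxE scaler_suml; apply: eq_bigr => j _.
  by rewrite !mxE scalerA.
rewrite (bigD1 i) //= !mxE eqxx scale1r big1 ?addr0 // => k /negPf ki.
by rewrite !mxE eq_sym ki scale0r.
Qed.

Lemma dimK_basis (V : set L) (d : nat) (b : 'I_d -> L) :
  is_basis V b -> dimK V = d.
Proof.
move=> Vb; rewrite /dimK; case: xgetP => [d' _ [b' Vb']|/(_ d)[]]; last by exists b.
by apply/eqP; rewrite eqn_leq (is_basis_leq Vb' Vb) (is_basis_leq Vb Vb').
Qed.

Lemma exists_basis (V : set L) (N : nat) (u : 'I_N -> L) :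
  V 0 -> (forall f g, V f -> V g -> V (f + g)) ->
  (forall (c : K) f, V f -> V (c *: f)) ->
  (forall v, V v -> exists! c : 'rV[K]_N, v = \sum_i c 0 i *: u i) ->
  exists d (b : 'I_d -> L), is_basis V b.
Proof.
move=> V0 VD VZ Vu.
pose comb (c : 'rV[K]_N) := \sum_i c 0 i *: u i.
have combM k (c : 'rV[K]_k) (A : 'M_(k, N)) :
    comb (c *m A) = \sum_i c 0 i *: comb (row i A).
  under [RHS]eq_bigr do rewrite scaler_sumr.
  rewrite exchange_big /=; apply: eq_bigr => i _.
  rewrite !mxE scaler_suml; apply: eq_bigr => j _.
  by rewrite !mxE scalerA.
have Vsum k (c : 'I_k -> K) (w : 'I_k -> L) :
    (forall i, V (w i)) -> V (\sum_i c i *: w i).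
  by move=> Vw; elim/big_ind: _ => // i _; apply: VZ.
pose P r := `[< exists A : 'M[K]_N, (forall i, V (comb (row i A))) /\ \rank A = r >].
have P0 : exists r, P r.
  exists 0%N; apply/asboolP; exists 0; split; last exact: mxrank0.
  by move=> i; rewrite /comb big1 // => j _; rewrite !mxE scale0r.
have PN r : P r -> (r <= N)%N.
  by move=> /asboolP[A [_ <-]]; apply: rank_leq_col.
have [r /asboolP[A [VA rA]] rmax] := ex_maxnP P0 PN.
have subA k (B : 'M_(k, N)) : (B <= A)%MS -> forall i, V (comb (row i B)).
  move=> /submxP[D ->] i; rewrite row_mul combM; exact: Vsum.
have inA v : V v -> exists2 c, v = comb c & (c <= A)%MS.
  move=> Vv; have [c [vE _]] := Vu v Vv; exists c => //.
  have le_r : (\rank (A + c)%MS <= \rank A)%N.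
    rewrite rA; apply: rmax; apply/asboolP; exists (A + c)%MS; split=> // i.
    have /sub_addsmxP[[D1 D2] ->] := row_sub i (A + c)%MS.
    have -> : comb (D1 *m A + D2 *m c) = comb (D1 *m A) + comb (D2 *m c).
      by rewrite -big_split /=; apply: eq_bigr => j _; rewrite mxE scalerDl.
    apply: VD; rewrite combM; apply: Vsum => // j.
    by have -> : row j c = c by [apply/rowP => l; rewrite mxE ord1]; rewrite -[comb c]vE.
  have := mxrank_leqif_sup (addsmxSl A c); move/geq_leqif.
  rewrite le_r => /esym; exact: submx_trans (addsmxSr A c).
exists (\rank A), (fun i => comb (row i (row_base A))); split=> [i|v Vv].
  by apply: subA; rewrite eq_row_base.
have [c vE] := inA v Vv; rewrite -(eq_row_base A) => /submxP[D cE].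
exists D; split=> [|D']; first by rewrite -combM -cE.
rewrite -combM => vE'; have [c0 [_ uc0]] := Vu v Vv.
apply: (row_free_inj (row_base_free A)).
by rewrite -cE -(uc0 c vE) -(uc0 _ vE').
Qed.

End Dimension.

Section Multigraded.
Variables (K : fieldType) (m : nat) (n : 'I_m -> nat).
Local Notation S := (multi_mpoly K n).

(* The degree in Z^m of a monomial: deg x_ij is the basis vector e_i. *)
Definition multideg (u : 'X_{1..\sum_i n i}) : 'rV[int]_m :=
  \sum_(v < \sum_i n i) delta_mx 0 (tagnat.sig1 v) *+ u v.

Definition graded_piece (I : set S) (a : 'rV[int]_m) : set S :=
  I `&` [set f | {in msupp f, forall u, multideg u = a}].

(* The formal series HS(I, y), as the family of its coefficients. *)
Definition HS (I : set S) : 'rV[int]_m -> nat :=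
  fun a => dimK (graded_piece I a).

Definition act (g : forall i, 'M[K]_(n i)) (f : S) : S :=
  f \mPo [tuple \sum_(k < n (tagnat.sig1 v))
            g (tagnat.sig1 v) k (tagnat.sig2 v) *: xvar K k
         | v < \sum_i n i].

(* is_trig_mx means lower triangular, hence the transposition. *)
Definition in_borel (g : forall i, 'M[K]_(n i)) : Prop :=
  forall i, is_trig_mx (g i)^T /\ forall j, g i j j != 0.

Definition borel_fixed (I : set S) : Prop :=
  forall g, in_borel g -> act g @` I = I.

Lemma act_xvar (g : forall i, 'M[K]_(n i)) (i : 'I_m) (j : 'I_(n i)) :
  act g (xvar K j) = \sum_(k < n i) g i k j *: xvar K k.
Proof.
rewrite /act /xvar comp_mpolyXU -tnth_nth tnth_mktuple.
rewrite tagnat.Rank2K; move: (congr1 _ _).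
rewrite tagnat.Rank1K => e; apply: eq_bigr => k _.
by congr (g _ _ _ *: _); apply: val_inj.
Qed.

Lemma act_borel_xvar (g : forall i, 'M[K]_(n i)) (i : 'I_m) (j : 'I_(n i)) :
  in_borel g ->
  act g (xvar K j) = \sum_(k < n i | (k <= j)%N) g i k j *: xvar K k.
Proof.
move=> /(_ i)[/is_trig_mxP tg _]; rewrite act_xvar [RHS]big_mkcond /=.
apply: eq_bigr => k _; case: leqP => // jk.
by have := tg _ _ jk; rewrite mxE => ->; rewrite scale0r.
Qed.

Lemma mdeg_multideg (u : 'X_{1..\sum_i n i}) :
  (mdeg u)%:Z = \sum_i multideg u 0 i.
Proof.
rewrite mdegE /multideg -natz natr_sum.
under [RHS]eq_bigr do rewrite summxE.
rewrite exchange_big /=; apply: eq_bigr => v _.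
under [RHS]eq_bigr do rewrite mulmxnE mxE eqxx /=.
rewrite [RHS](bigD1 (tagnat.sig1 v)) //= eqxx [X in _ + X]big1 ?addr0 //.
by move=> i /negPf ->; rewrite mul0rn.
Qed.

Lemma graded_piece_basis (I : set S) (a : 'rV[int]_m) : is_ideal I ->
  exists b : 'I_(HS I a) -> S, is_basis (graded_piece I a) b.
Proof.
move=> [I0 ID IM].
suff [d [b Vb]] : exists d (b : 'I_d -> S), is_basis (graded_piece I a) b.
  by rewrite /HS (dimK_basis Vb); exists b.
pose B := (absz (\sum_i a 0 i)).+1.
pose T := 'X_{1..(\sum_i n i) < B}.
pose M (k : 'I_#|{: T}|) := bmnm (enum_val k).
pose u k : S := 'X_[M k].
have coefE (c : 'rV[K]_#|{: T}|) k :
    (\sum_i c 0 i *: u i)@_(M k) = c 0 k.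
  rewrite raddf_sum (bigD1 k) //= mcoeffZ mcoeffX eqxx mulr1 [X in _ + X]big1 ?addr0 //.
  move=> i /negPf ik; rewrite mcoeffZ mcoeffX.
  have -> : (M i == M k) = (i == k) by rewrite -[RHS](inj_eq enum_val_inj).
  by rewrite ik mulr0.
apply: (@exists_basis _ _ _ _ u).
- by split=> // v; rewrite msupp0.
- move=> f g [If hf] [Ig hg]; split; first exact: ID.
  by move=> v /msuppD_le; rewrite mem_cat => /orP[/hf|/hg].
- move=> c f [If hf]; split; first by rewrite -mul_mpolyC; apply: IM.
  by move=> v /msuppZ_le /hf.
move=> f [_ hf]; exists (\row_k f@_(M k)); split=> [|c ->]; last first.
  by apply/rowP => k; rewrite mxE coefE.
have fB : (msize f <= B)%N.
  rewrite msizeE; apply/bigmax_leqP_seq => v /hf va _; rewrite ltnS.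
  by rewrite -va -mdeg_multideg absz_nat.
rewrite {1}(mpolywE fB).
pose F (v : T) : S := f@_(bmnm v) *: 'X_[bmnm v].
rewrite -/(\sum_(v : T) F v).
have -> : \sum_(v : T) F v = \sum_(v in {: T}) F v by apply: eq_bigl => v.
by rewrite [LHS]big_enum_val; apply: eq_bigr => k _; rewrite mxE.
Qed.

End Multigraded.

(* Main.v *)
Require Import Defs.
From mathcomp Require Import all_boot all_order all_algebra.
From mathcomp Require Import zify.
From mathcomp Require Import boolp classical_sets functions cardinality.
From mathcomp Require Import mpoly.

(* Torus invariance makes Borel fixed ideals monomial, and unipotent elements
   show that they are stable under replacing x_ij^e by x_ik^e (k < j) in a
   monomial of exact exponent e in x_ij, in any characteristic.

   For a set T of variables closed under passing to smaller indices, let h_T(a)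
   count the monomials of degree a in the variables of T outside the ideal. If
   v is the last variable of T in its block i, multiplication by v is injective
   modulo the ideal once a_i is large, so h_(T - v)(a + e_i) is the difference
   h_T(a + e_i) - h_T(a). Hence HS(I) = HS(J) forces h_T^I = h_T^J in large
   degrees. For a monomial u of J, take for T the variables that do not come
   after the first variable of u in their block: every monomial in T of large
   degree in the blocks of u is in J, so it is also in I, which gives a power of
   u in I. So J is contained in rad(I) = I, and equality follows by dimension. *)

Set Implicit Arguments.
Unset Strict Implicit.
Unset Printing Implicit Defensive.

Import GRing.Theory.

(** * Dickson's lemma *)

(** Each chosen index minimizes [g] over all indices after the previous one, so its value is at most
    every later chosen value. *)
Lemma nondecreasing_subsequence (g : nat -> nat) :
  exists phi : nat -> nat, (forall i, phi i < phi i.+1) /\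
    forall i j, i <= j -> g (phi i) <= g (phi j).
Proof.
have next k : exists j, k < j /\ forall l, k < l -> g j <= g l.
  pose P x := `[< exists2 j, k < j & g j = x >].
  have exP : exists x, P x by exists (g k.+1); apply/asboolP; exists k.+1.
  have [_ /asboolP[j kj <-] jmin] := ex_minnP exP.
  by exists j; split=> // l kl; apply: jmin; apply/asboolP; exists l.
have [nxt nxtP] := choice next.
exists (fun i => iter i.+1 nxt 0); split=> [i|i j ij].
  by have [] := nxtP (iter i.+1 nxt 0).
have [_] := nxtP (iter i nxt 0); apply.
elim: j ij => [|j IHj]; first by rewrite leqn0 => /eqP ->; have [] := nxtP 0.
rewrite leq_eqVlt => /orP[/eqP ->|/IHj /ltn_trans]; first by have [] := nxtP (iter j.+1 nxt 0).
by apply; have [] := nxtP (iter j.+1 nxt 0).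
Qed.

Lemma nondecreasing_subsequence_mnm (N : nat) (f : nat -> 'X_{1..N}) :
  exists phi : nat -> nat, (forall i, phi i < phi i.+1) /\
    forall i j, i <= j -> (f (phi i) <= f (phi j))%MM.
Proof.
suff [phi [phiS phiP]] : exists phi : nat -> nat, (forall i, phi i < phi i.+1) /\
    forall v, v \in enum 'I_N -> forall i j, i <= j -> f (phi i) v <= f (phi j) v.
  exists phi; split=> // i j ij; apply/mnm_lepP => v.
  by apply: phiP => //; rewrite mem_enum.
elim: (enum 'I_N) => [|v s [phi [phiS phiP]]]; first by exists id.
have [psi [psiS psiP]] := nondecreasing_subsequence (fun i => f (phi i) v).
exists (phi \o psi); split=> [i|w].
  by apply: (homo_ltn ltn_trans phiS); apply: psiS.
rewrite in_cons => /orP[/eqP -> i j /psiP //|ws i j ij].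
apply: phiP => //; exact: (homo_leq leqnn leq_trans (fun k => ltnW (psiS k))).
Qed.

(* The form of Dickson's lemma in which the exponents of the minimal elements
   of [M] are all at most [e]. *)
Lemma dickson (N : nat) (M : pred 'X_{1..N}) :
  (forall u w, (u <= w)%MM -> M u -> M w) ->
  exists e, forall u, M u -> M [multinom minn (u v) e | v < N].
Proof.
move=> Mup; apply: contrapT => /forallNP noe.
have /choice[f fP] : forall e, exists u : 'X_{1..N},
    M u /\ ~ M [multinom minn (u v) e | v < N].
  by move=> e; have /existsNP[u /not_implyP Hu] := noe e; exists u.
have [phi [phiS phiP]] := nondecreasing_subsequence_mnm f.
have phi_ge i : i <= phi i by elim: i => // i /leq_ltn_trans; apply.
(* The exponents of [f (phi 0)] are at most [k <= phi k], so truncating [f (phi k)] at [phi k]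
   leaves it above [f (phi 0)], hence in [M]. *)
have [] := fP (phi (mdeg (f (phi 0)))); set k := mdeg _ => _; apply.
apply: Mup (fP (phi 0)).1; apply/mnm_lepP => v.
rewrite mnmE leq_min (mnm_lepP (phiP 0 k _)) //=.
apply: leq_trans (phi_ge k); rewrite /k mdegE (bigD1 v) //=; exact: leq_addr.
Qed.

(** * Monomials in blocks of variables and moves *)

Section BlockMonomials.
Variables (N m : nat) (blk : 'I_N -> 'I_m) (pos : 'I_N -> nat).
Hypothesis blk_pos_inj : forall v w, blk v = blk w -> pos v = pos w -> v = w.

Implicit Types (u z : 'X_{1..N}) (M : pred 'X_{1..N}) (T : pred 'I_N).

Definition bdeg u (i : 'I_m) := \sum_(v | blk v == i) u v.

Lemma bdegD u z i : bdeg (u + z)%MM i = bdeg u i + bdeg z i.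
Proof. by rewrite /bdeg -big_split /=; apply: eq_bigr => v _; rewrite mnmDE. Qed.

Lemma bdeg1 v i : bdeg U_(v)%MM i = (blk v == i).
Proof.
have [vi|vi] := eqVneq (blk v) i.
  rewrite /bdeg (bigD1 v) ?vi //= mnm1E eqxx big1 // => w /andP[_ wv].
  by rewrite mnm1E eq_sym (negPf wv).
rewrite /bdeg big1 // => w /eqP wi; rewrite mnm1E.
by have [e|//] := eqVneq v w; rewrite -wi e eqxx in vi.
Qed.

Lemma mdeg_bdeg u : mdeg u = \sum_i bdeg u i.
Proof. by rewrite mdegE (partition_big blk predT). Qed.

Lemma leq_bdeg u v : u v <= bdeg u (blk v).
Proof. by rewrite /bdeg (bigD1 v) //= leq_addr. Qed.

Lemma bdeg_pigeonhole u i D : N * D < bdeg u i -> exists2 v, blk v = i & D < u v.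
Proof.
move=> lt; apply: contrapT => noe; move: lt; rewrite ltnNge => /negP; apply.
rewrite /bdeg (leq_trans (n := \sum_(v < N) D)) //; last by rewrite sum_nat_const card_ord.
rewrite big_mkcond; apply: leq_sum => v _; case: eqP => // vi.
by rewrite leqNgt; apply/negP => Dv; apply: noe; exists v.
Qed.

(** The bound on the total degree provides a finite type to enumerate; by [mdeg_bdeg] it excludes no
    monomial of block degree [a]. *)
Definition monos (a : 'I_m -> nat) : seq 'X_{1..N} :=
  [seq bmnm x | x : 'X_{1..N < (\sum_i a i).+1} <-
     enum {: 'X_{1..N < (\sum_i a i).+1}} & [forall i, bdeg x i == a i]].

Lemma monos_uniq a : uniq (monos a).
Proof.
rewrite map_inj_uniq => [|x y xy]; first exact/filter_uniq/enum_uniq.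
by apply/eqP; rewrite bmeqP; apply/eqP.
Qed.

Lemma monosP a u : reflect (bdeg u =1 a) (u \in monos a).
Proof.
apply: (iffP mapP) => [[z + ->]|ua].
  by rewrite mem_filter => /andP[/forallP za _] i; apply/eqP.
have ud : mdeg u < (\sum_i a i).+1.
  by rewrite mdeg_bdeg ltnS; apply: leq_sum => i _; rewrite ua.
exists (BMultinom ud) => //; rewrite mem_filter mem_enum andbT.
by apply/forallP => i; rewrite /= ua.
Qed.

Definition move u v w : 'X_{1..N} :=
  [multinom if x == v then 0 else if x == w then u w + u v else u x | x < N].

Lemma mdeg_move u v w : v != w -> mdeg (move u v w) = mdeg u.
Proof.
move=> vw; rewrite !mdegE (bigD1 v) //= (bigD1 w) 1?eq_sym //=.
rewrite [RHS](bigD1 v) //= [in RHS](bigD1 w) 1?eq_sym //=.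
rewrite !mnmE !eqxx [w == v]eq_sym (negPf vw) add0n addnA [_ + u w]addnC.
congr addn; apply: eq_bigr => x /andP[xv xw].
by rewrite mnmE (negPf xv) (negPf xw).
Qed.

Definition up_closed M := forall u z, (u <= z)%MM -> M u -> M z.
(** The whole power of [v] moves at once: in positive characteristic a Borel fixed ideal need not
    contain the monomials where only a part of it moves. *)
Definition move_closed M := forall u v w,
  blk w = blk v -> pos w < pos v -> M u -> M (move u v w).

(* Moving the power of a bad variable v (z v < u v) to a variable where z has room
   for the whole of u produces no new bad variable. *)
Lemma mem_of_moves M u z : up_closed M -> move_closed M -> M u ->
  (forall v, z v < u v ->
    exists d, [/\ blk d = blk v, pos d <= pos v & mdeg u <= z d]) ->
  M z.
Proof.
move=> Mup Mmv.
have [k] := ubnP #|[pred v | z v < u v]|.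
elim: k u => // k IHk u ltk Mu uz.
have [le|] := boolP (u <= z)%MM; first exact: Mup le Mu.
rewrite negb_forall => /existsP[v]; rewrite -ltnNge => zuv.
have [d [dv pdv uzd]] := uz _ zuv.
have le_mdeg x : u x <= mdeg u by rewrite mdegE (bigD1 x) //= leq_addr.
have vd : v != d by apply: contraL zuv => /eqP ->; rewrite -leqNgt (leq_trans (le_mdeg d)).
have bad x : z x < move u v d x -> z x < u x /\ x != v.
  rewrite mnmE; case: (x =P v) => // xv; case: (x =P d) => [->|//].
  rewrite ltnNge (leq_trans _ uzd) //.
  by rewrite mdegE (bigD1 d) //= (bigD1 v) //= addnA leq_addr.
apply: (IHk (move u v d)).
- rewrite -ltnS; apply: leq_trans ltk; rewrite ltnS; apply: proper_card.
  apply/fintype.properP; split; first by apply/fintype.subsetP => x; rewrite !inE => /bad[].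
  by exists v; rewrite !inE //; apply/negP => /bad[]; rewrite eqxx.
- apply: Mmv => //; rewrite ltn_neqAle pdv andbT.
  by apply: contraNneq vd => e; rewrite (blk_pos_inj _ e).
by move=> x /bad[/uz]; rewrite mdeg_move.
Qed.

(** * Hilbert functions on subsets of the variables *)

Definition supported T u := [forall v, (u v != 0) ==> T v].

Lemma supportedP T u : reflect (forall v, 0 < u v -> T v) (supported T u).
Proof.
apply: (iffP forallP) => H v; first by rewrite lt0n; apply/implyP.
by apply/implyP; rewrite -lt0n; apply: H.
Qed.

Definition last_in_block T v :=
  T v /\ forall w, T w -> blk w = blk v -> pos w <= pos v.

(** By Dickson, the product can be truncated to some [u'] in [M] with exponents at most [e], and
    [u'] exceeds [u] at most at [v]. In large degree, [u] contains a high power of a variable [d] of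
    the block; [d] is in [T], so it does not come after [v] and can receive its power. *)
Lemma mul_last_regular M : up_closed M -> move_closed M ->
  exists D, forall T v u, last_in_block T v -> supported T u ->
    D <= bdeg u (blk v) -> M (U_(v) + u)%MM -> M u.
Proof.
move=> Mup Mmv; have [e eP] := dickson Mup.
(* [N * e] bounds the degree of [u'], and the outer factor [N] comes from the pigeonhole over the
   variables. *)
exists (N * (N * e)).+1 => T v u [Tv vlast] /supportedP uT Du /eP.
set u' := [multinom _ | _ < _] => Mu'; apply: (mem_of_moves Mup Mmv Mu') => x.
have u'N : mdeg u' <= N * e.
  rewrite mdegE (leq_trans (n := \sum_(v < N) e)) //; last by rewrite sum_nat_const card_ord.
  by apply: leq_sum => w _; rewrite mnmE geq_minr.
rewrite mnmE mnmDE mnm1E; case: eqP => [<- _|_]; last by rewrite add0n ltnNge geq_minl.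
have [d dv ud] := bdeg_pigeonhole Du.
exists d; split=> //; last exact: leq_trans u'N (ltnW ud).
by apply: vlast => //; apply: uT; apply: leq_ltn_trans ud.
Qed.

(** The Hilbert function of the polynomial ring on [T] modulo the monomials of [M]. *)
Definition hilb M T a := count (fun u => supported T u && ~~ M u) (monos a).

(** Numerical form of the exact sequence for multiplication by [v]. The monomials outside [M] that
    [v] divides are [v] times those of degree [a] outside [M], the last hypothesis being injectivity
    modulo [M]; the others avoid [v], so they are supported on [T']. *)
Lemma hilb_step M T T' v a : up_closed M -> T v ->
  (forall w, T' w = T w && (w != v)) ->
  (forall u, supported T u -> bdeg u =1 a -> M (U_(v) + u)%MM -> M u) ->
  hilb M T (fun i => (blk v == i) + a i) =
  hilb M T a + hilb M T' (fun i => (blk v == i) + a i).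
Proof.
move=> Mup Tv T'E st; set a' := fun i => _.
have T'P u : supported T' u = supported T u && (u v == 0).
  apply/supportedP/andP => [H|[/supportedP H /eqP uv] w uw].
    split; first by apply/supportedP => w /H; rewrite T'E => /andP[].
    by rewrite -leqn0 leqNgt; apply/negP => /H; rewrite T'E eqxx andbF.
  by rewrite T'E H //=; apply: contraTneq uw => ->; rewrite uv.
rewrite /hilb -[in LHS]size_filter -(count_predC (fun u => u v != 0)).
rewrite !count_filter; congr addn; last first.
  by apply: eq_count => u /=; rewrite T'P negbK andbCA andbA.
rewrite -!size_filter -[RHS](size_map (mnm_add U_(v)%MM)); apply: perm_size.
apply: uniq_perm.
- by rewrite filter_uniq ?monos_uniq.
- rewrite map_inj_uniq ?filter_uniq ?monos_uniq //; exact: addmI.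
have sE u : supported T (U_(v) + u)%MM = supported T u.
  apply/supportedP/supportedP => H w.
    by move=> uw; apply: H; rewrite mnmDE addn_gt0 uw orbT.
  by rewrite mnmDE mnm1E; case: eqP => [<-|_] // /H.
move=> u; rewrite mem_filter; apply/idP/mapP.
  move=> /andP[/andP[/= uv /andP[uT nMu]] /monosP ua].
  have uE : u = (U_(v) + (u - U_(v)))%MM by rewrite addmC submK // lep1mP.
  exists (u - U_(v))%MM => //; rewrite mem_filter -sE -uE uT /=.
  apply/andP; split; first by apply: contra nMu; apply: Mup; apply: lem_subr.
  apply/monosP => i; have := ua i; rewrite {1}uE bdegD bdeg1; exact: addnI.
move=> [z + ->]; rewrite mem_filter /= => /andP[/andP[zT nMz] /monosP za].
rewrite sE zT mnmDE mnm1E eqxx /=; apply/andP; split.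
  by apply: contra nMz; apply: st.
by apply/monosP => i; rewrite bdegD bdeg1 za.
Qed.

Definition lower_closed T := forall v w, T v ->
  blk w = blk v -> pos w <= pos v -> T w.

(** Induction on the number of variables missing from [T]. The missing variable [v] of least
    position is last in its block once put back, so [hilb_step] expresses the count for [T] through
    two counts for [T']. Only degrees in blocks with missing variables have to be large. *)
Lemma eq_hilb_large M1 M2 (A : pred 'I_m) :
  up_closed M1 -> move_closed M1 -> up_closed M2 -> move_closed M2 ->
  (forall a, hilb M1 predT a = hilb M2 predT a) ->
  forall T, lower_closed T -> (forall v, ~~ T v -> A (blk v)) ->
  exists D, forall a, (forall i, A i -> D <= a i) -> hilb M1 T a = hilb M2 T a.
Proof.
move=> up1 mv1 up2 mv2 eq12 T.
have [D1 st1] := mul_last_regular up1 mv1; have [D2 st2] := mul_last_regular up2 mv2.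
have [k] := ubnP #|predC T|; elim: k T => // k IHk T ltk Tlow TA.
have [T1|/forallPn[v0 Tv0]] := boolP [forall v, T v].
  exists 0 => a _; have -> : T = predT by apply/funext => v; rewrite (forallP T1).
  exact: eq12.
pose v := [arg min_(v < v0 | ~~ T v) pos v].
have [Tv vmin] : ~~ T v /\ forall w, ~~ T w -> pos v <= pos w.
  by rewrite /v; case: arg_minnP => // w; split.
pose T' w := T w || (w == v).
have T'low : lower_closed T'.
  move=> x w /orP[Tx wx pw|/eqP -> wv pw]; first by rewrite /T' (Tlow x).
  rewrite /T'; have [//|/= nTw] := boolP (T w).
  by apply/eqP/blk_pos_inj => //; apply/eqP; rewrite eqn_leq pw vmin.
have vlast : last_in_block T' v.
  split=> [|w /orP[Tw wv|/eqP -> //]]; first by rewrite /T' eqxx orbT.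
  by rewrite leqNgt; apply: contra Tv => lt; apply: (Tlow w) => //; exact: ltnW.
have TE w : T w = T' w && (w != v).
  by rewrite /T'; case: eqP => [->|_]; rewrite ?andbF ?andbT ?orbF //; apply/negbTE.
have [||D HD] := IHk T' _ T'low.
- rewrite -ltnS; apply: leq_trans ltk; rewrite ltnS; apply: proper_card.
  apply/fintype.properP; split.
    by apply/fintype.subsetP => x; rewrite !inE negb_or => /andP[].
  by exists v; rewrite !inE /= /T' ?eqxx ?orbT.
- by move=> w; rewrite negb_or => /andP[/TA].
(* The successor keeps [b], which is [a] lowered by one in the block of [v], above all three
   thresholds. *)
exists (maxn D (maxn D1 D2)).+1 => a Da.
pose b i := a i - (blk v == i).
have aE : a = (fun i => (blk v == i) + b i).
  apply/funext => i; rewrite /b; case: eqP => [vi|_]; last by rewrite subn0.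
  by rewrite subnKC // -vi (leq_trans _ (Da _ (TA _ Tv))).
have Db i : A i -> maxn D (maxn D1 D2) <= b i.
  by move=> /Da; rewrite [in X in X -> _]aE; case: (_ == _); lia.
have Db' i : A i -> D <= b i by move=> /Db; lia.
have Da' i : A i -> D <= a i by move=> /Da; lia.
have := HD a Da'; rewrite aE.
have Dv := Db _ (TA _ Tv).
rewrite (hilb_step up1 vlast.1 TE) => [|u uT' ub]; last first.
  by apply: (st1 T') => //; rewrite ub; lia.
rewrite (hilb_step up2 vlast.1 TE) => [|u uT' ub]; last first.
  by apply: (st2 T') => //; rewrite ub; lia.
by rewrite (HD b Db') => /addnI.
Qed.

Lemma power_mem M1 M2 u :
  up_closed M1 -> move_closed M1 -> up_closed M2 -> move_closed M2 ->
  (forall a, hilb M1 predT a = hilb M2 predT a) ->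
  M2 u -> exists k, M1 (u *+ k)%MM.
Proof.
move=> up1 mv1 up2 mv2 eq12 Mu.
(* [A] is the set of blocks met by [u]; every other block lies entirely in [T]. *)
pose A i := [exists v, (0 < u v) && (blk v == i)].
pose T w := [forall v, (0 < u v) && (blk v == blk w) ==> (pos w <= pos v)].
have TP w : reflect (forall v, 0 < u v -> blk v = blk w -> pos w <= pos v) (T w).
  apply: (iffP forallP) => [H v uv vw|H v]; first by apply: (implyP (H v)); rewrite uv vw eqxx.
  by apply/implyP => /andP[uv /eqP]; apply: H.
have [|v|D HD] := eq_hilb_large (A := A) (T := T) up1 mv1 up2 mv2 eq12.
- move=> v w /TP Tv wv pw; apply/TP => x ux xw.
  by apply: leq_trans pw _; apply: Tv => //; rewrite xw.
- rewrite negb_forall => /existsP[x]; rewrite negb_imply => /andP[ux _].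
  by apply/existsP; exists x.
(* [D] reaches the range where the counts agree; the other bound forces, by pigeonhole, an exponent
   above the degree of [u]. *)
pose k := maxn D (N * mdeg u).+1.
(* The product of the [k]-th powers of the first variable of [u] in each block of [A]; it divides
   the [k]-th power of [u] and is supported on [T]. *)
pose w := [multinom if (0 < u v) && T v then k else 0 | v < N].
have wA i : A i -> k <= bdeg w i.
  move=> /existsP[v0 v0P].
  pose v := [arg min_(v < v0 | (0 < u v) && (blk v == i)) pos v].
  have [/andP[uv /eqP vi] vmin] : ((0 < u v) && (blk v == i)) /\
      forall x, (0 < u x) && (blk x == i) -> pos v <= pos x.
    by rewrite /v; case: arg_minnP => // x; split.
  rewrite -vi; apply: leq_trans (leq_bdeg w v); rewrite mnmE uv.
  by case: TP => // -[x ux xv]; apply: vmin; rewrite ux xv vi eqxx.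
(* In each block of [u], such a [z] has a variable [d] of exponent at least the degree of [u]. As
   [d] is in [T], no variable of [u] in the block precedes it, so [d] can receive all their
   powers. *)
have h2 : hilb M2 T (bdeg w) = 0.
  apply/eqP; rewrite /hilb -leqn0 leqNgt -has_count; apply/hasPn => z /monosP zw.
  rewrite negb_and negbK -implybE; apply/implyP => /supportedP zT.
  apply: (mem_of_moves up2 mv2 Mu) => v zuv.
  have uv : 0 < u v by exact: leq_ltn_trans zuv.
  have Av : A (blk v) by apply/existsP; exists v; rewrite uv eqxx.
  have zv : N * mdeg u < bdeg z (blk v).
    by rewrite zw; apply: leq_trans (wA _ Av); rewrite leq_max leqnn orbT.
  have [d dv uzd] := bdeg_pigeonhole zv.
  exists d; split=> //; last exact: ltnW.
  have /TP Td : T d by apply: zT; apply: leq_ltn_trans uzd.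
  exact: Td.
have := HD (bdeg w); rewrite h2 => h1.
have /eqP : hilb M1 T (bdeg w) = 0.
  by apply: h1 => i /wA; apply: leq_trans; rewrite leq_maxl.
rewrite /hilb -leqn0 leqNgt -has_count => /hasPn /(_ w).
have -> : w \in monos (bdeg w) by apply/monosP.
have -> : supported T w by apply/supportedP => v; rewrite mnmE; case: andP => [[]|].
rewrite negbK => /(_ isT) Mw; exists k; apply: up1 Mw.
apply/mnm_lepP => v; rewrite mnmE mulmnE; case: andP => [[uv _]|] //.
by rewrite leq_pmull.
Qed.

(** Once [M2] is contained in [M1], a monomial of [M1] outside [M2] would make the finite counts
    differ in its degree. *)
Lemma radical_unique M1 M2 :
  up_closed M1 -> move_closed M1 -> up_closed M2 -> move_closed M2 ->
  (forall a, count M1 (monos a) = count M2 (monos a)) ->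
  (forall u k, M1 (u *+ k)%MM -> M1 u) -> M1 =1 M2.
Proof.
move=> up1 mv1 up2 mv2 eq12 rad1 u.
have hilbE M a : hilb M predT a = size (monos a) - count M (monos a).
  rewrite -(count_predC M (monos a)) addKn; apply: eq_count => z /=.
  by rewrite (_ : supported _ z) //; apply/supportedP.
have sub z : M2 z -> M1 z.
  move=> /(power_mem up1 mv1 up2 mv2)[a|k]; first by rewrite !hilbE eq12.
  exact: rad1.
apply/idP/idP => [M1u|/sub //]; apply: contrapT => /negP nM2u.
pose s := monos (bdeg u).
have : count (predI M1 M2) s + count (predI M1 (predC M2)) s = count M1 s.
  rewrite -[RHS]size_filter -(count_predC M2) !count_filter.
  by congr addn; apply: eq_count => z /=; rewrite andbC.
rewrite eq12 (_ : count (predI M1 M2) s = count M2 s); last first.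
  by apply: eq_count => z /=; apply: andb_idl; apply: sub.
move=> /eqP; rewrite -[X in _ == X]addn0 eqn_add2l; apply/negP.
rewrite -lt0n -has_count; apply/hasP; exists u; first by apply/monosP.
by rewrite /= M1u nM2u.
Qed.

End BlockMonomials.

Local Open Scope classical_set_scope.
Local Open Scope ring_scope.

(** * Borel fixed ideals and their monomials *)

Lemma exists_expr_neq (K : fieldType) (a b : nat) : infinite_set [set: K] ->
  a != b -> exists s : K, s != 0 /\ s ^+ a != s ^+ b.
Proof.
(* Raising both exponents by one makes 0 a root of [p], so that a non-root is automatically
   nonzero. *)
move=> Kinf ab; pose p : {poly K} := 'X^(a.+1) - 'X^(b.+1).
have p0 : p != 0.
  apply/eqP => /(congr1 (fun q : {poly K} => q`_a.+1)).
  rewrite coef0 coefB !coefXn eqxx eqSS (negPf ab) subr0; exact/eqP/oner_neq0.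
have [B _ sB] := infinite_set_fset (size p) Kinf.
have /allPn[s sB' ps] : ~~ all (root p) (finmap.enum_fset B).
  by apply/negP => /(max_poly_roots p0)/(_ (finmap.fset_uniq B)); rewrite ltnNge sB.
exists s; split.
  by apply: contraNneq ps => ->; rewrite /root !hornerE !expr0n /= subr0.
apply: contra ps => /eqP e; rewrite /root !hornerE.
by rewrite !exprS e subrr.
Qed.

Section BorelFixed.
Variables (K : fieldType) (m : nat) (n : 'I_m -> nat).
Local Notation N := (\sum_i n i)%N.
Local Notation blk := (@tagnat.sig1 m n).
Local Notation pos := (fun v : 'I_N => val (tagnat.sig2 v)).
Implicit Types (u w : 'X_{1..N}) (I : set (multi_mpoly K n)).

Lemma tagnat_sig_inj (v w : 'I_N) : blk v = blk w -> pos v = pos w -> v = w.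
Proof.
move=> e1 e2; rewrite -(tagnat.sig2K v) -(tagnat.sig2K w).
by apply/val_inj/eqP; rewrite /= tagnat.eq_Rank; apply/andP; split; apply/eqP.
Qed.

(** A group element is given by one matrix on all the variables, of which only the diagonal blocks
    are read; this avoids indices in dependent types. *)
Definition flat_mx (h : 'I_N -> 'I_N -> K) (i : 'I_m) : 'M[K]_(n i) :=
  \matrix_(k, j) h (tagnat.Rank i k) (tagnat.Rank i j).

Lemma act_flat_mx h (x : 'I_N) :
  act (flat_mx h) 'X_x = \sum_(y | blk y == blk x) h y x *: 'X_y.
Proof.
rewrite -[in LHS](tagnat.sig2K x) [LHS]act_xvar.
rewrite [RHS](reindex (@tagnat.rank m n)) /=; last exact/onW_bij/tagnat.rank_bij.
rewrite (eq_bigl (fun p : {i & 'I_(n i)} => (tag p == blk x) && true)); last first.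
  by move=> p; rewrite /= tagnat.rankE tagnat.Rank1K andbT.
under [RHS]eq_bigr do rewrite tagnat.rankE.
rewrite -(sig_big_dep (fun i => i == blk x) (fun _ _ => true)
  (fun i (j : 'I_(n i)) => h (tagnat.Rank i j) x *: 'X_(tagnat.Rank i j))).
rewrite big_pred1_eq; apply: eq_bigr => k _.
by rewrite mxE tagnat.sig2K.
Qed.

Lemma actX (g : forall i, 'M[K]_(n i)) u :
  act g 'X_[u] = \prod_v act g 'X_v ^+ u v.
Proof.
rewrite /act comp_mpolyX; apply: eq_bigr => v _.
by rewrite comp_mpolyXU -tnth_nth.
Qed.

Lemma act_sum (g : forall i, 'M[K]_(n i)) (f : multi_mpoly K n) :
  act g f = \sum_(u <- msupp f) f@_u *: act g 'X_[u].
Proof. exact: comp_mpolyEX. Qed.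

Definition torus_mx (t : 'I_N -> K) := flat_mx (fun y x => (y == x)%:R * t x).

Lemma act_torus t u :
  act (torus_mx t) 'X_[u] = (\prod_v t v ^+ u v) *: 'X_[u].
Proof.
rewrite actX [in RHS]mpolyXE_id -scaler_prod; apply: eq_bigr => v _.
rewrite -exprZn; congr (_ ^+ _); rewrite act_flat_mx [LHS](bigD1 v) //= eqxx mul1r.
rewrite [X in _ + X]big1 ?addr0 // => y /andP[_ /negPf ->].
by rewrite mul0r scale0r.
Qed.

Lemma torus_borel t : (forall v, t v != 0) -> in_borel (torus_mx t).
Proof.
move=> t0 i; split=> [|j]; last by rewrite mxE eqxx mul1r.
apply/is_trig_mxP => k j kj; rewrite !mxE -val_eqE tagnat.eq_Rank eqxx.
by rewrite gtn_eqF // mul0r.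
Qed.

(** Induction on the size of the support. If [f] has another monomial [w], a torus element scaling
    one variable separates it from [u]; subtracting a multiple of [f] from the image of [f] cancels
    [w] and keeps [u]. *)
Lemma borel_fixed_monomial I : infinite_set [set: K] -> is_ideal I ->
  borel_fixed I -> forall f u, I f -> u \in msupp f -> I 'X_[u].
Proof.
move=> Kinf [I0 ID IM] Ib f; have IZ c g : I g -> I (c *: g).
  by rewrite -mul_mpolyC; apply: IM.
have [k] := ubnP (size (msupp f)); elim: k f => // k IHk f ltk u If uf.
have [/allP f1|/allPn[w wf wu]] := boolP (all (pred1 u) (msupp f)).
  have fE : f = f@_u *: 'X_[u].
    apply/mpolyP => w; rewrite mcoeffZ mcoeffX; case: eqP => [->|/eqP uw]; first by rewrite mulr1.
    rewrite mulr0; apply: memN_msupp_eq0; apply: contra uw => /f1 /eqP -> //.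
  have fu : f@_u != 0 by rewrite -mcoeff_msupp.
  by rewrite -['X_[u]]scale1r -(mulVf fu) -scalerA -fE; apply: IZ.
have [v uwv] : exists v, u v != w v.
  apply/existsP; rewrite -negb_forall; apply: contra wu => /forallP H.
  by apply/eqP/mnmP => v; rewrite (eqP (H v)).
have [s [s0 suw]] := exists_expr_neq Kinf uwv.
pose t x := if x == v then s else 1.
have tE (z : 'X_{1..N}) : \prod_x t x ^+ z x = s ^+ z v.
  rewrite [LHS](bigD1 v) //= /t eqxx [X in _ * X]big1 ?mulr1 // => x /negPf ->; exact: expr1n.
pose g := act (torus_mx t) f - s ^+ w v *: f.
have gE z : g@_z = (s ^+ z v - s ^+ w v) * f@_z.
  rewrite mcoeffB mcoeffZ mulrBl; congr (_ - _).
  rewrite act_sum (eq_bigr (fun x : 'X_{1..N} => (s ^+ x v * f@_x) *: 'X_[x])); last first.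
    by move=> x _; rewrite act_torus tE scalerA mulrC.
  have [zf|zf] := boolP (z \in msupp f).
    rewrite raddf_sum (bigD1_seq z) ?msupp_uniq //= mcoeffZ mcoeffX eqxx mulr1.
    by rewrite [X in _ + X]big1 ?addr0 //= => x /negPf xz; rewrite mcoeffZ mcoeffX xz mulr0.
  rewrite (memN_msupp_eq0 zf) mulr0 raddf_sum big_seq [LHS]big1 //= => x xf.
  by rewrite mcoeffZ mcoeffX; case: eqP xf zf => [->->|]; rewrite ?mulr0.
have Ig : I g.
  apply: ID; last by rewrite -scaleNr; apply: IZ.
  rewrite -(Ib (torus_mx t)); first by exists f.
  by apply: torus_borel => x; rewrite /t; case: ifP; rewrite ?oner_neq0.
have gf z : z \in msupp g -> z \in msupp f /\ z != w.
  rewrite !mcoeff_msupp gE mulf_eq0 negb_or subr_eq0 => /andP[sz fz]; split=> //.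
  by apply: contraNneq sz => ->.
apply: (IHk g) => //; last by rewrite mcoeff_msupp gE mulf_neq0 ?subr_eq0 // -mcoeff_msupp.
rewrite -ltnS; apply: leq_trans ltk; rewrite ltnS.
have /uniq_leq_size : uniq (w :: msupp g).
  by rewrite /= msupp_uniq andbT; apply/negP => /gf[_]; rewrite eqxx.
by apply=> z; rewrite in_cons => /orP[/eqP ->|/gf[]].
Qed.

(** The unipotent substitution of x_v + x_w for x_v sends the monomial to (x_v + x_w)^e times a
    monomial [u0] free of x_v. The moved monomial is a term of this product, and [I] contains the
    terms of its elements. *)
Lemma borel_fixed_move I : infinite_set [set: K] -> is_ideal I ->
  borel_fixed I -> forall u (v w : 'I_N), blk w = blk v -> (pos w < pos v)%N ->
  I 'X_[u] -> I 'X_[move u v w].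
Proof.
move=> Kinf Ii Ib u v w wv lt Iu.
have vw : v != w by apply: contraTneq lt => ->; rewrite ltnn.
pose h (y x : 'I_N) : K := (y == x)%:R + ((y == w) && (x == v))%:R.
have hB : in_borel (flat_mx h).
  move=> i; split=> [|j].
    apply/is_trig_mxP => k j kj; rewrite !mxE /h -val_eqE tagnat.eq_Rank eqxx.
    rewrite gtn_eqF //= add0r; case: andP => // -[/eqP jw /eqP kv].
    by move: lt; rewrite -jw -kv !tagnat.Rank2K /= ltnNge ltnW.
  rewrite mxE /h eqxx; case: andP => [[/eqP -> /eqP wv']|_]; last by rewrite addr0 oner_neq0.
  by rewrite wv' eqxx in vw.
have hv : act (flat_mx h) 'X_v = 'X_v + 'X_w.
  rewrite act_flat_mx [LHS](bigD1 v) //=.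
  rewrite [X in _ + X = _](bigD1 w) ?wv ?eqxx 1?eq_sym //=.
  rewrite [X in _ + (_ + X)]big1 => [|y].
    by rewrite /h !eqxx (negPf vw) [w == v]eq_sym (negPf vw) !addr0 add0r !scale1r.
  by move=> /andP[/andP[_ /negPf yv] /negPf yw]; rewrite /h yv yw addr0 scale0r.
have hx x : x != v -> act (flat_mx h) 'X_x = 'X_x.
  move=> /negPf xv; rewrite act_flat_mx [LHS](bigD1 x) //=.
  rewrite [X in _ + X]big1 => [|y /andP[_ /negPf yx]].
    by rewrite /h eqxx xv andbF !addr0 scale1r.
  by rewrite /h yx xv andbF addr0 scale0r.
apply: (borel_fixed_monomial Kinf Ii Ib (f := act (flat_mx h) 'X_[u])).
  by rewrite -(Ib _ hB); exists 'X_[u].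
pose u0 : 'X_{1..N} := [multinom if x == v then 0 else u x | x < N]%N.
have -> : act (flat_mx h) 'X_[u] = ('X_v + 'X_w) ^+ u v * 'X_[u0].
  rewrite actX [LHS](bigD1 v) //= hv (mpolyXE_id _ u0).
  rewrite [X in _ = _ * X](bigD1 v) //= mnmE eqxx mul1r.
  by congr (_ * _); apply: eq_bigr => x xv; rewrite hx // mnmE (negPf xv).
have -> : move u v w = (u0 + U_(w) *+ u v)%MM.
  apply/mnmP => x; rewrite mnmDE mulmnE mnm1E !mnmE [w == x]eq_sym.
  case: (x =P v) => [->|_]; first by rewrite (negPf vw).
  by case: eqP => [->|_]; rewrite ?mul1n ?mul0n ?addn0.
(* x_w^e has coefficient 1 in (x_v + x_w)^e whatever the characteristic. *)
rewrite mcoeff_msupp mcoeffMX exprDn raddf_sum big_ord_recr /= [X in X + _]big1 ?add0r => [|i _] /=.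
  by rewrite subnn expr0 mul1r binn mulr1n mcoeffXn eqxx oner_neq0.
(* The remaining binomial terms keep a positive power of x_v, so they are other monomials. *)
rewrite mcoeffMn !mpolyXn -mpolyXD mcoeffX; case: eqP => [|_]; last by rewrite mul0rn.
move=> /(congr1 (fun z : 'X_{1..N} => z v)); rewrite mnmDE !mulmnE !mnm1E eqxx.
by rewrite [w == v]eq_sym (negPf vw) !mul0n addn0 mul1n => /eqP; rewrite subn_eq0 leqNgt ltn_ord.
Qed.

Lemma multidegE u : multideg u = \row_i (bdeg blk u i)%:Z.
Proof.
apply/rowP => i; rewrite mxE summxE /bdeg -natz natr_sum [RHS]big_mkcond.
apply: eq_bigr => v _; rewrite mulmxnE mxE eqxx /= eq_sym.
by case: eqP => // _; rewrite mul0rn.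
Qed.

(** The monomials of degree [a] in a monomial ideal form a basis of its graded piece. *)
Lemma HS_count I (a : 'I_m -> nat) : is_ideal I ->
  (forall f u, I f -> u \in msupp f -> I 'X_[u]) ->
  HS I (\row_i (a i)%:Z) = count (fun u => `[< I 'X_[u] >]) (monos blk a).
Proof.
move=> [I0 ID IM] Imon; rewrite -size_filter; set s := filter _ _.
have sU : uniq s by rewrite filter_uniq // monos_uniq.
have multidegP u : multideg u = \row_i (a i)%:Z -> u \in monos blk a.
  move=> ua; apply/monosP => i; have := congr1 (fun r : 'rV[int]_m => r 0 i) ua.
  by rewrite multidegE !mxE => -[].
apply: (dimK_basis (b := fun i : 'I_(size s) => 'X_[nth 0%MM s i])).
have coefE (c : 'rV[K]_(size s)) (i : 'I_(size s)) :
    (\sum_j c 0 j *: 'X_[nth 0%MM s j])@_(nth 0%MM s i) = c 0 i.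
  rewrite raddf_sum (bigD1 i) //= mcoeffZ mcoeffX eqxx mulr1 [X in _ + X]big1 ?addr0 //= => j ji.
  by rewrite mcoeffZ mcoeffX nth_uniq // (inj_eq val_inj) (negPf ji) mulr0.
split=> [i|f [If fa]].
  have := mem_nth 0%MM (ltn_ord i); rewrite mem_filter => /andP[/asboolP Iu /monosP ua].
  split=> // u /=; rewrite msuppX inE => /eqP ->.
  by rewrite multidegE; apply/rowP => j; rewrite !mxE ua.
exists (\row_i f@_(nth 0%MM s i)); split=> [|c ->]; last first.
  by apply/rowP => i; rewrite mxE coefE.
apply/mpolyP => u; have [us|us] := boolP (u \in s).
  have lt : (index u s < size s)%N by rewrite index_mem.
  by rewrite -(nth_index 0%MM us) (coefE _ (Ordinal lt)) mxE.
rewrite memN_msupp_eq0; last first.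
  apply: contra us => uf; rewrite mem_filter; apply/andP; split.
    exact/asboolP/(Imon f).
  exact/multidegP/fa.
rewrite raddf_sum [RHS]big1 //= => i _; rewrite mcoeffZ mcoeffX.
by case: eqP us => [<-|_]; rewrite ?mulr0 // mem_nth.
Qed.

End BorelFixed.

(** * Passage from monomials to ideals *)

Theorem theorem2p5 (K : fieldType) (m : nat) (n : 'I_m -> nat)
  (I J : set (multi_mpoly K n)) :
  infinite_set [set: K] ->
  is_ideal I -> is_ideal J ->
  borel_fixed I -> borel_fixed J ->
  HS I = HS J ->
  radical I = I ->
  I = J.
Proof.
move=> Kinf Ii Ij Ib Jb eqHS Irad.
have ideal_up (L : set (multi_mpoly K n)) : is_ideal L ->
    up_closed (fun u => `[< L 'X_[u] >]).
  move=> [_ _ LM] u z uz /asboolP Lu; apply/asboolP.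
  by rewrite -(submK uz) mpolyXD; apply: LM.
have ideal_move (L : set (multi_mpoly K n)) : is_ideal L -> borel_fixed L ->
    move_closed (@tagnat.sig1 m n) (fun v => val (tagnat.sig2 v))
      (fun u => `[< L 'X_[u] >]).
  move=> Li Lb u v w wv lt /asboolP Lu; apply/asboolP.
  exact: borel_fixed_move.
(* A Borel fixed ideal is the span of its monomials, so it suffices to compare monomials. *)
have monE (L : set (multi_mpoly K n)) f : is_ideal L -> borel_fixed L ->
    L f <-> {in msupp f, forall u, L 'X_[u]}.
  move=> Li Lb; split=> [Lf u|Lf]; first exact: borel_fixed_monomial Lf.
  rewrite (mpolyE f); case: Li => L0 LD LM.
  rewrite big_seq; elim/big_ind: _ => // u uf.
  by rewrite -mul_mpolyC; apply/LM/Lf.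
have IJ := radical_unique (@tagnat_sig_inj m n) (ideal_up _ Ii) (ideal_move _ Ii Ib)
  (ideal_up _ Ij) (ideal_move _ Ij Jb).
apply/funext => f; apply/propext; rewrite !monE //.
suff eqIJ u : I 'X_[u] <-> J 'X_[u] by split=> H u /H /eqIJ.
suff /(_ u) e : (fun u => `[< I 'X_[u] >]) =1 (fun u => `[< J 'X_[u] >]).
  by split=> /asboolP; [rewrite e | rewrite -e] => /asboolP.
apply: IJ => [a|z k /asboolP Iz].
  rewrite -!HS_count ?eqHS //; exact: borel_fixed_monomial.
by apply/asboolP; rewrite -Irad; exists k; rewrite mpolyXn.
Qed.
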